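(* Consider the following homogeneous cubic vector field on $\mathbb{R}^2$ parameterized by the scalar $\theta$: $$\begin{pmatrix}\dot{x} \\ \dot{y}\end{pmatrix} =\begin{pmatrix}-\sin(\theta) & \cos(\theta)\\-\cos(\theta)&-\sin(\theta) \end{pmatrix} \begin{pmatrix}x^3 \\ y^3\end{pmatrix}.$$ There exists a range of values (an interval of positive length) for the parameter $\theta>0$ for which the vector field is asymptotically stable, has no homogeneous polynomial Lyapunov function of degree $6$, but admits a homogeneous polynomial Lyapunov function of degree $4$.
   Context: A vector field $\dot{z}=f(z)$ on $\mathbb{R}^n$ with $f(0)=0$ is called asymptotically stable if its origin is asymptotically stable: (i) for every $\epsilon>0$ there exists $\delta=\delta(\epsilon)>0$ such that $\|z(0)\|<\delta$ implies $\|z(t)\|<\epsilon$ for all $t\geq 0$, and (ii) $\delta$ can be chosen such that $\|z(0)\|<\delta$ implies $\lim_{t\rightarrow\infty}z(t)=0$. (For homogeneous vector fields, local and global asymptotic stability are equivalent.) A homogeneous polynomial Lyapunov function of degree $d$ for $\dot{z}=f(z)$ is a homogeneous polynomial $V:\mathbb{R}^n\to\mathbb{R}$ of degree $d$ (all monomials have degree $d$) such that $V(z)>0$ for all $z\neq 0$ and $\dot{V}(z)=\langle \nabla V(z),f(z)\rangle<0$ for all $z\neq 0$. *)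

(* Defs.v *)
From HB Require Import structures.
From mathcomp Require Import all_boot all_order all_algebra.
From mathcomp Require Import all_classical all_reals all_analysis.
(* The notations of mpoly clash with those of mathcomp-analysis. *)
From mathcomp Require Import -(notations) mpoly.
Set Implicit Arguments.
Unset Strict Implicit.
Unset Printing Implicit Defensive.
Import Order.TTheory GRing.Theory Num.Theory numFieldNormedType.Exports.
Local Open Scope classical_set_scope.
Local Open Scope ring_scope.

(* At [t = 0] only right-continuity is required, as the values of [z] at
   negative times are irrelevant; when [f] is continuous this forces the
   one-sided derivative of [z] at [0] to be [f (z 0)]. *)
Definition trajectory (R : realType) (n : nat)
    (f : 'cV[R]_n -> 'cV[R]_n) (z : R -> 'cV[R]_n) : Prop :=
  {within `[0, +oo[, continuous z} /\
  (forall t : R, 0 < t -> is_derive t 1 z (f (z t))).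

(* [`|z|] is the max norm; as all norms on R^n are equivalent, the notion does
   not depend on this choice. The second conjunct, implicit in "z(t) for all
   t >= 0", prevents the last two from holding vacuously when solutions blow up
   in finite time. *)
Definition asymptotically_stable (R : realType) (n : nat)
    (f : 'cV[R]_n -> 'cV[R]_n) : Prop :=
  [/\ f 0 = 0,
      exists2 delta : R, 0 < delta &
        forall z0 : 'cV[R]_n, `|z0| < delta ->
          exists2 z, trajectory f z & z 0 = z0,
      forall eps : R, 0 < eps -> exists2 delta : R, 0 < delta &
        forall z, trajectory f z -> `|z 0| < delta ->
          forall t, 0 <= t -> `|z t| < eps
    & exists2 delta : R, 0 < delta &
        forall z, trajectory f z -> `|z 0| < delta ->
          z t @[t --> +oo] --> (0 : 'cV[R]_n)].

Definition eval_at (R : realType) (n : nat) (V : mpoly n R)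
    (z : 'cV[R]_n) : R :=
  meval (fun i => z i 0) V.

Definition grad (R : realType) (n : nat) (V : mpoly n R)
    (z : 'cV[R]_n) : 'cV[R]_n :=
  \col_i eval_at (mderiv i V) z.

Definition orbital_derivative (R : realType) (n : nat)
    (f : 'cV[R]_n -> 'cV[R]_n) (V : mpoly n R) (z : 'cV[R]_n) : R :=
  \sum_i grad V z i 0 * f z i 0.

Definition homogeneous_lyapunov (R : realType) (n d : nat)
    (f : 'cV[R]_n -> 'cV[R]_n) (V : mpoly n R) : Prop :=
  [/\ V \is ishomog1 d mdeg,
      forall z, z != 0 -> 0 < eval_at V z
    & forall z, z != 0 -> orbital_derivative f V z < 0].

Definition cubic_matrix (R : realType) (theta : R) : 'M[R]_2 :=
  \matrix_(i, j)
    if i == j then - sin theta else if i == 0 then cos theta else - cos theta.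

Definition cubic_field (R : realType) (theta : R) (z : 'cV[R]_2) : 'cV[R]_2 :=
  cubic_matrix theta *m map_mx (fun u => u ^+ 3) z.

(* Main.v *)
(** The quartic x^4 + y^4 has orbital derivative -4 sin(theta) (x^6 + y^6), which
    gives stability and the Lyapunov function of degree 4. For theta = 0 it is a
    conserved quantity whose level sets are periodic orbits, so a sextic that is
    nonincreasing along the flow would be a multiple of (x^4 + y^4)^(3/2), which
    is not a polynomial. Quantitatively, a sextic Lyapunov function may be
    averaged over the quarter turn, which leaves three coefficients, and
    finitely many evaluations contradict each other for all small theta.
    The definition of stability also requires trajectories to exist for all
    positive times: Picard iteration provides them for a globally Lipschitz
    truncation of the field that agrees with it near the origin. *)

Require Import Defs.
From mathcomp Require Import all_boot all_order all_algebra.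
From mathcomp Require Import all_classical all_reals all_analysis.
From mathcomp Require Import -(notations) mpoly.
From mathcomp Require Import ring lra.
Import Order.TTheory GRing.Theory Num.Theory numFieldNormedType.Exports.
Local Open Scope classical_set_scope.
Local Open Scope ring_scope.

(** * Primitives and differential inequalities *)

(** The domain of integration is empty for negative [t], so this primitive vanishes there instead of
    being a signed integral. Picard iterates are therefore constant at negative times. *)
Definition primitive {R : realType} (g : R -> R) (t : R) : R :=
  parameterized_integral lebesgue_measure 0 t g.

Lemma primitive_le0 {R : realType} (g : R -> R) (t : R) : t <= 0 ->
  primitive g t = 0.
Proof.
rewrite /primitive /parameterized_integral le_eqVlt => /orP[/eqP ->|t0].
  by rewrite set_itv1 Rintegral_set1.
by rewrite set_itv_ge ?Rintegral_set0// bnd_simp -ltNge.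
Qed.

Lemma is_derive_primitive {R : realType} (g : R -> R) (t : R) :
  continuous g -> 0 < t -> is_derive t 1 (primitive g) (g t).
Proof.
move=> cg t0.
(* The margin [t + 1] makes [t] an interior point of the interval of integration. *)
have ig : lebesgue_measure.-integrable `[0, t + 1] (EFin \o g).
  apply: continuous_compact_integrable; first exact: segment_compact.
  exact: continuous_subspaceT.
have tt1 : t < t + 1 by rewrite ltrDl.
have [dg gE] := continuous_FTC1_closed tt1 ig t0 (cg t).
by apply: DeriveDef => //; rewrite -derive1E.
Qed.

Lemma continuous_primitive {R : realType} (g : R -> R) :
  continuous g -> continuous (primitive g).
Proof.
move=> cg t; have [t0|t0|->] := ltgtP t 0.
- rewrite /continuous_at primitive_le0 ?(ltW t0)//; apply: cvg_near_cst.
  near=> s; apply: primitive_le0; apply: ltW.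
  by near: s; exact: lt_nbhsl.
- have [dg _] := is_derive_primitive _ _ cg t0.
  exact/differentiable_continuous/derivable1_diffP.
- rewrite /continuous_at primitive_le0//.
  apply: (@parameterized_integral_cvg_left _ 0 1) => //.
  apply: continuous_compact_integrable; first exact: segment_compact.
  exact: continuous_subspaceT.
Unshelve. all: by end_near. Qed.

Lemma is_derive_nonincreasing {R : realType} (f df : R -> R) (s t : R) :
  {within `[0, +oo[, continuous f} ->
  (forall u : R, 0 < u -> is_derive u 1 f (df u)) ->
  (forall u : R, 0 < u -> df u <= 0) ->
  0 <= s -> s <= t -> f t <= f s.
Proof.
move=> cf fdf df0 s0 st.
have df1 u : u \in `]0, t[ -> is_derive u 1 f (df u).
  by rewrite in_itv => /andP[u0 _]; exact: fdf.
apply: (@ler0_derive1_le_cc _ f 0 t) => //.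
- by move=> u /df1[].
- move=> u ut; have [_ uE] := df1 u ut.
  by rewrite derive1E uE df0//; move: ut; rewrite in_itv => /andP[].
- apply: continuous_subspaceW cf => u/=.
  by rewrite !in_itv/= => /andP[->].
- by rewrite in_itv/= (le_trans s0)// lexx.
- by rewrite in_itv/= s0.
Qed.

(** Both [G] and [- G], after subtracting [C * expR (K * u)], are nonincreasing on the half-line and
    start at [- C]. Passing from the derivative to the function gains a factor [K], the source of
    the contraction below. *)
Lemma exp_growth_bound {R : realType} (G g : R -> R) (C K t : R) :
  continuous G -> G 0 = 0 ->
  (forall u : R, 0 < u -> is_derive u 1 G (g u)) ->
  (forall u : R, 0 < u -> `|g u| <= C * K * expR (K * u)) ->
  0 <= C -> 0 <= t -> `|G t| <= C * expR (K * t).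
Proof.
move=> cG G0 dG gle C0 t0.
have cE : continuous (fun u : R => C * expR (K * u)).
  move=> u; apply: cvgMr; apply: continuous_comp; last exact: continuous_expR.
  by apply: cvgMr; exact: cvg_id.
have dE (u : R) : is_derive u 1 (fun u => C * expR (K * u)) (C * K * expR (K * u)).
  by apply: is_derive_eq; rewrite /GRing.scale/=; ring.
rewrite ler_norml; apply/andP; split.
- rewrite -subr_ge0 -oppr_le0.
  have := @is_derive_nonincreasing R (fun u : R => - G u - C * expR (K * u))
    (fun u => - g u - C * K * expR (K * u)) 0 t.
  rewrite G0 mulr0 expR0 oppr0 => H.
  have : - G t - C * expR (K * t) <= 0 - C * 1.
    apply: H => //.
    + apply: continuous_subspaceT => u.
      by apply: cvgB; [apply: cvgN; exact: cG|exact: cE].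
    + by move=> u u0; apply: is_deriveB; apply: is_deriveN; exact: dG.
    + by move=> u u0; have := gle _ u0; rewrite ler_norml => /andP[]; lra.
  by lra.
- have := @is_derive_nonincreasing R (fun u : R => G u - C * expR (K * u))
    (fun u => g u - C * K * expR (K * u)) 0 t.
  rewrite G0 mulr0 expR0 => H.
  have : G t - C * expR (K * t) <= 0 - C * 1.
    apply: H => //.
    + apply: continuous_subspaceT => u.
      by apply: cvgB; [exact: cG|exact: cE].
    + by move=> u u0; apply: is_deriveB; exact: dG.
    + by move=> u u0; have := gle _ u0; rewrite ler_norml => /andP[]; lra.
  by lra.
Qed.

Lemma is_derive_sqr_max0 {R : realType} (x : R) :
  is_derive x 1 (fun u => Num.max u 0 ^+ 2) (2 * Num.max x 0).
Proof.
have [x0|x0|->] := ltgtP x 0.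
- rewrite mulr0; apply: (@near_eq_is_derive _ _ _ (cst 0)).
  near=> u; rewrite max_r ?expr0n//.
  by apply: ltW; near: u; exact: lt_nbhsl.
- apply: (@near_eq_is_derive _ _ _ (fun u : R => u ^+ 2)).
    near=> u; rewrite max_l//.
    by apply: ltW; near: u; exact: lt_nbhsr.
  by apply: is_derive_eq; rewrite /GRing.scale/=; ring.
- rewrite mulr0.
  (* At the kink the difference quotient is [h] for positive [h] and 0 otherwise. *)
  have H : (fun h : R => h^-1 *: ((fun u : R => Num.max u 0 ^+ 2) (h *: 1 + 0)
      - Num.max (0 : R) 0 ^+ 2)) @ 0^' --> (0 : R).
    apply/cvgrPdist_le => e e0; near=> h.
    have h0 : h != 0 by near: h; exact: nbhs_dnbhs_neq.
    have he : `|h| <= e by near: h; exact: dnbhs0_le.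
    rewrite maxxx expr0n subr0 sub0r normrN addr0 /GRing.scale/= mulr1.
    have [h1|h1] := leP h 0; first by rewrite expr0n mulr0 normr0 ltW.
    by rewrite expr2 mulKf.
  by apply: DeriveDef; [apply/cvg_ex; exists 0|apply: cvg_lim].
Unshelve. all: by end_near. Qed.

(* Composing [v] with [u |-> - max (m - u) 0 ^ 2], which is C^1, increasing
   below [m] and constant above it, makes the derivative nonpositive everywhere,
   so that no first exit time from the sublevel set is needed. *)
Lemma sublevel_trapping {R : realType} (v dv : R -> R) (m t : R) :
  {within `[0, +oo[, continuous v} ->
  (forall u : R, 0 < u -> is_derive u 1 v (dv u)) ->
  (forall u : R, 0 < u -> v u < m -> dv u <= 0) ->
  v 0 < m -> 0 <= t -> v t <= v 0.
Proof.
move=> cv dvP dv0 v0m t0.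
pose p (u : R) := - (Num.max (m - u) 0 ^+ 2).
have dp (u : R) : is_derive u 1 p (2 * Num.max (m - u) 0).
  have -> : p = - ((fun w : R => Num.max w 0 ^+ 2) \o (fun w => m - w)) by [].
  rewrite -[X in is_derive _ _ _ X]opprK; apply: is_deriveN.
  rewrite -[X in is_derive _ _ _ X]mulrN1; apply: is_derive1_comp.
    exact: is_derive_sqr_max0.
  by apply: is_derive_eq; rewrite add0r mul1r.
have cp : continuous p.
  by move=> u; apply/differentiable_continuous/derivable1_diffP; have [] := dp u.
have : p (v t) <= p (v 0).
  apply: (@is_derive_nonincreasing R (p \o v)
    (fun u => 2 * Num.max (m - v u) 0 * dv u)) => //.
  - by apply: within_continuous_comp cv => u _; exact: cp.
  - by move=> u u0; apply: is_derive1_comp; exact: dvP.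
  - move=> u u0; have [um|um] := ltP (v u) m; last first.
      by rewrite max_r ?mulr0 ?mul0r// subr_le0.
    rewrite mulr_ge0_le0 ?dv0// mulr_ge0// le_max; by rewrite subr_ge0 ltW.
have max0 (u : R) : Num.max u 0 \is Num.nneg by rewrite nnegrE le_max lexx orbT.
(* What remains is [max (m - v 0) 0 <= max (m - v t) 0]. Since [m - v 0] is positive, the maximum on
   the right must be [m - v t]. *)
rewrite /p lerN2 ler_pXn2r//.
rewrite ge_max => /andP[+ _]; rewrite le_max => /orP[]; lra.
Qed.

(** * Global existence for Lipschitz vector fields *)

Lemma ler_coord_norm {R : realType} {n : nat} (v : 'cV[R]_n) (i : 'I_n) :
  `|v i 0| <= `|v|.
Proof.
rewrite [leRHS]/Num.Def.normr/= mx_normrE.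
exact: (le_bigmax _ (fun ij : 'I_n * 'I_1 => `|v ij.1 ij.2|) (i, 0)).
Qed.

Lemma col_norm_le {R : realType} {n : nat} (v : 'cV[R]_n) (C : R) :
  0 <= C -> (forall i, `|v i 0| <= C) -> `|v| <= C.
Proof.
move=> C0 vC; rewrite /Num.Def.normr/= mx_normrE bigmax_le// => -[i j] _.
by rewrite (ord1 j).
Qed.

Lemma continuous_col {R : realType} {n : nat} (z : R -> 'cV[R]_n) :
  (forall i, continuous (fun t => z t i 0)) -> continuous z.
Proof.
move=> cz t; apply/cvgrPdist_le => e e0; near=> s.
apply: col_norm_le; first exact: ltW.
move=> i; rewrite !mxE; move: i; near: s; apply: filter_forall => i.
exact: ((cvgrPdist_le _ _).1 (cz i t)).
Unshelve. all: by end_near. Qed.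

Lemma is_derive_col {R : realType} {n : nat} (z : R -> 'cV[R]_n) (t : R)
    (v : 'cV[R]_n) :
  (forall i, is_derive t 1 (fun s => z s i 0) (v i 0)) -> is_derive t 1 z v.
Proof.
move=> dz; have dz' : derivable z t 1.
  by apply/derivable_mxP => i j; rewrite (ord1 j); have [] := dz i.
apply: DeriveDef => //; rewrite derive_mx//; apply/matrixP => i j.
by rewrite mxE (ord1 j); have [] := dz i.
Qed.

Lemma is_derive_coord {R : realType} {n : nat} (z : R -> 'cV[R]_n) (t : R)
    (v : 'cV[R]_n) (i : 'I_n) :
  is_derive t 1 z v -> is_derive t 1 (fun s => z s i 0) (v i 0).
Proof.
move=> [dz <-]; apply: DeriveDef; first by move/derivable_mxP : dz; exact.
by rewrite derive_mx// mxE.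
Qed.

Lemma exists_div_exp2_lt {R : realType} (C e : R) : 0 <= C -> 0 < e ->
  exists k, C / 2 ^+ k < e.
Proof.
move=> C0 e0; have C1 : 0 < C + 1 by rewrite ltr_wpDl.
have [k _ /(_ k (leqnn k))] :=
  near_infty_natSinv_expn_lt (PosNum (divr_gt0 e0 C1)).
rewrite /= div1r ltr_pdivlMr// => kC; exists k.
apply: le_lt_trans kC; rewrite mulrC ler_wpM2l ?invr_ge0 ?exprn_ge0//.
by rewrite lerDl.
Qed.

Section picard.
Context {R : realType} {n : nat} (f : 'cV[R]_n -> 'cV[R]_n) (L : R).
Hypothesis L0 : 0 < L.
Hypothesis fL : forall x y, `|f x - f y| <= L * `|x - y|.
Variable z0 : 'cV[R]_n.

Let picard_operator (z : R -> 'cV[R]_n) (t : R) : 'cV[R]_n :=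
  z0 + \col_i primitive (fun s => f (z s) i 0) t.

Local Notation T := picard_operator.

Let lipschitz_continuous : continuous f.
Proof.
move=> x; apply/(@cvgrPdist_le R 'cV[R]_n _ (nbhs x) (nbhs_filter x)) => e e0.
near=> y.
apply: le_trans (fL x y) _; rewrite mulrC -ler_pdivlMr//.
near: y; apply/nbhs_ballP; exists (e / L); first exact: divr_gt0.
by move=> y /=; rewrite -ball_normE => /ltW.
Unshelve. all: by end_near. Qed.

Let continuous_rhs (z : R -> 'cV[R]_n) (i : 'I_n) :
  continuous z -> continuous (fun s => f (z s) i 0).
Proof.
move=> cz t; apply: (@continuous_comp _ _ _ (f \o z) (fun M : 'cV[R]_n => M i 0)).
  by apply: continuous_comp; [exact: cz|exact: lipschitz_continuous].
exact: coord_continuous.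
Qed.

Let picardE z t i : T z t i 0 = z0 i 0 + primitive (fun s => f (z s) i 0) t.
Proof. by rewrite !mxE. Qed.

Let picard_le0 (z : R -> 'cV[R]_n) (t : R) : t <= 0 -> T z t = z0.
Proof.
move=> t0; apply/matrixP => i j.
by rewrite (ord1 j) picardE primitive_le0// addr0.
Qed.

Let continuous_picard (z : R -> 'cV[R]_n) : continuous z -> continuous (T z).
Proof.
move=> cz; apply: continuous_col => i.
rewrite (_ : (fun t => _) =
    fun t => z0 i 0 + primitive (fun s => f (z s) i 0) t).
  move=> t; apply: cvgD; first exact: cvg_cst.
  exact/continuous_primitive/continuous_rhs.
by apply/funext => t; rewrite picardE.
Qed.

Let is_derive_picard_coord (z : R -> 'cV[R]_n) (t : R) i : continuous z -> 0 < t ->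
  is_derive t 1 (fun s => T z s i 0) (f (z t) i 0).
Proof.
move=> cz t0.
rewrite (_ : (fun t => _) =
    fun t => z0 i 0 + primitive (fun s => f (z s) i 0) t).
  rewrite -[f (z t) i 0]add0r; apply: is_deriveD.
  apply: (is_derive_primitive (fun s => f (z s) i 0)) => //.
  exact: continuous_rhs.
by apply/funext => s; rewrite picardE.
Qed.

(* In the norm weighted by [expR (- 2 L |t|)], the Picard operator contracts by
   the factor 1/2 on the whole half-line, so the solution is global at once. *)
Let weight (t : R) : R := expR (2 * L * `|t|).

Let picard_growth (z w : R -> 'cV[R]_n) (C : R) :
  continuous z -> continuous w -> 0 <= C ->
  (forall t : R, 0 < t -> `|f (z t) - f (w t)| <= C * (2 * L) * weight t) ->
  forall t, `|T z t - T w t| <= C * weight t.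
Proof.
move=> cz cw C0 zw t; have [t0|t0] := leP t 0.
  by rewrite !picard_le0// subrr normr0 mulr_ge0// expR_ge0.
apply: col_norm_le; first by rewrite mulr_ge0// expR_ge0.
move=> i; rewrite /weight (gtr0_norm t0).
have := @exp_growth_bound R (fun s => T z s i 0 - T w s i 0)
  (fun s => f (z s) i 0 - f (w s) i 0) C (2 * L) t.
rewrite !mxE; apply; rewrite ?(ltW t0)//.
- move=> s; apply: cvgB.
    apply: (@continuous_comp _ _ _ (T z) (fun M : 'cV[R]_n => M i 0)).
      exact: continuous_picard.
    exact: coord_continuous.
  apply: (@continuous_comp _ _ _ (T w) (fun M : 'cV[R]_n => M i 0)).
    exact: continuous_picard.
  exact: coord_continuous.
- by rewrite !primitive_le0// subrr.
- by move=> u u0; apply: is_deriveB; exact: is_derive_picard_coord.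
- move=> u u0; have := zw u u0; rewrite /weight (gtr0_norm u0).
  apply: le_trans; have := ler_coord_norm (f (z u) - f (w u)) i.
  by rewrite !mxE.
Qed.

Let picard_contraction (z w : R -> 'cV[R]_n) (C : R) :
  continuous z -> continuous w -> 0 <= C ->
  (forall t : R, `|z t - w t| <= C * weight t) ->
  forall t, `|T z t - T w t| <= C / 2 * weight t.
Proof.
move=> cz cw C0 zw; apply: picard_growth => // [|t t0].
  by rewrite divr_ge0.
apply: le_trans (fL _ _) _.
(* The Lipschitz bound costs [L] while integrating against the weight gains [2 * L], which leaves
   the factor 1/2. *)
rewrite [leRHS](_ : _ = L * (C * weight t)); last by field.
by rewrite ler_pM2l.
Qed.

Let iterate (k : nat) : R -> 'cV[R]_n := iter k T (cst z0).

Let continuous_iterate k : continuous (iterate k).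
Proof.
elim: k => [|k IH]; last exact: continuous_picard.
by move=> t; exact: cvg_cst.
Qed.

(** Chosen so that [M * (2 * L)] is the norm of the constant velocity [f z0] of the first iterate;
    hence the first step is at most [M] in the weighted norm. *)
Let M : R := `|f z0| / (2 * L).

Let M0 : 0 <= M.
Proof. by rewrite divr_ge0// mulr_ge0// ltW. Qed.

Let iterate_step k (t : R) :
  `|iterate k.+1 t - iterate k t| <= M / 2 ^+ k * weight t.
Proof.
elim: k t => [|k IH] t; last first.
  rewrite exprSr invfM mulrA.
  apply: (picard_contraction (iterate k.+1) (iterate k)) => //.
  by rewrite divr_ge0.
rewrite expr0 divr1; have [t0|t0] := leP t 0.
  by rewrite [iterate 1 t]picard_le0// subrr normr0 mulr_ge0// expR_ge0.
apply: col_norm_le; first by rewrite mulr_ge0// expR_ge0.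
move=> i; rewrite [iterate 1 t]/= !mxE addrAC subrr add0r.
rewrite /weight (gtr0_norm t0).
apply: (@exp_growth_bound R _ (fun s => f z0 i 0)); rewrite ?(ltW t0)//.
- exact/continuous_primitive/(continuous_rhs (cst z0))/(continuous_iterate 0).
- by rewrite primitive_le0.
- move=> u u0; apply: (is_derive_primitive (fun s => f (cst z0 s) i 0)) => //.
  exact/(continuous_rhs (cst z0))/(continuous_iterate 0).
- move=> u u0; rewrite /M divfK; last by rewrite gt_eqF// mulr_gt0.
  apply: le_trans (ler_coord_norm _ _) _; rewrite ler_peMr//.
  by rewrite -expR0 ler_expR mulr_ge0// ?mulr_ge0// ltW.
Qed.

Let iterate_dist k j (t : R) :
  `|iterate (k + j) t - iterate k t| <= 2 * M / 2 ^+ k * weight t.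
Proof.
(* The induction needs the exact partial sum of the geometric series: [2 - 2 / 2 ^+ j] is the sum of
   [1 / 2 ^+ i] for [i < j]. *)
suff : `|iterate (k + j) t - iterate k t|
    <= (2 - 2 / 2 ^+ j) * (M / 2 ^+ k * weight t).
  move=> /le_trans; apply.
  have w0 : 0 <= M / 2 ^+ k * weight t.
    by rewrite mulr_ge0 ?expR_ge0// divr_ge0.
  have j0 : 0 <= 2 / 2 ^+ j :> R by rewrite divr_ge0.
  rewrite [leRHS](_ : _ = 2 * (M / 2 ^+ k * weight t)); last by rewrite !mulrA.
  by apply: ler_wpM2r => //; lra.
elim: j => [|j IH].
  by rewrite addn0 subrr normr0 expr0 divr1 subrr mul0r.
rewrite -(subrK (iterate (k + j) t) (iterate (k + j.+1) t)) -addrA.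
apply: le_trans (ler_normD _ _) _.
apply: le_trans (lerD _ IH) _; first by rewrite addnS; exact: iterate_step.
rewrite exprS exprD; set w := weight t.
rewrite le_eqVlt; apply/orP; left; apply/eqP.
by field; rewrite !expf_neq0.
Qed.

Let weight_ge0 t : 0 <= weight t.
Proof. exact: expR_ge0. Qed.

Let bound_ge0 t : 0 <= 2 * M * weight t.
Proof. by apply: mulr_ge0 => //; apply: mulr_ge0. Qed.

Let iterate_cvg t : cvg (iterate k t @[k --> \oo]).
Proof.
apply/cauchy_cvgP/cauchyP => e e0.
have [|k ke] := @exists_div_exp2_lt R (2 * M * weight t) e _ e0.
  exact: bound_ge0.
exists (iterate k t); exists k => // j /= kj.
rewrite -ball_normE /ball_/= distrC -(subnKC kj).
apply: le_lt_trans (iterate_dist _ _ _) _.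
by rewrite mulrAC.
Qed.

Let z (t : R) : 'cV[R]_n := lim (iterate k t @[k --> \oo]).

Let limit_dist k t : `|z t - iterate k t| <= 2 * M / 2 ^+ k * weight t.
Proof.
apply/ler_addgt0Pr => e e0.
have /cvgrPdist_le/(_ e e0)[j _ zj] := iterate_cvg t.
have {}zj := zj (k + j)%N (leq_addl _ _).
rewrite -(subrK (iterate (k + j) t) (z t)) -addrA [leRHS]addrC.
by apply: le_trans (ler_normD _ _) _; apply: lerD.
Qed.

Let continuous_limit : continuous z.
Proof.
move=> t; apply/cvgrPdist_le => e e0.
have e3 : 0 < e / 3 by rewrite divr_gt0.
(* The weight is at most [weight (|t| + 1)] on the unit neighbourhood of [t], so the convergence is
   locally uniform and a three-epsilon argument applies. *)
have [|k ke] := @exists_div_exp2_lt R (2 * M * weight (`|t| + 1)) (e / 3) _ e3.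
  exact: bound_ge0.
have zk s : `|s| <= `|t| + 1 -> `|z s - iterate k s| <= e / 3.
  move=> st; apply: le_trans (limit_dist k s) _.
  rewrite mulrAC; apply: le_trans (ltW ke).
  rewrite ler_wpM2r ?invr_ge0 ?exprn_ge0//.
  apply: ler_wpM2l; first exact: mulr_ge0.
  rewrite /weight ler_expR ler_wpM2l ?mulr_ge0 ?(ltW L0)//.
  by apply: le_trans st _; exact: ler_norm.
near=> s.
have st : `|s| <= `|t| + 1.
  have : `|t - s| <= 1.
    by near: s; apply: (cvgr_dist_le (fun s : R => s)) => //; exact: cvg_id.
  have := ler_normB t (t - s); rewrite opprB addrC subrK; lra.
have ks : `|iterate k t - iterate k s| <= e / 3.
  near: s; exact: ((cvgrPdist_le _ _).1 (@continuous_iterate k t) _ e3).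
have -> : z t - z s =
    (z t - iterate k t) + (iterate k t - iterate k s) - (z s - iterate k s).
  by rewrite addrA subrK opprB addrA subrK.
apply: le_trans (ler_normB _ _) _.
apply: le_trans (lerD (ler_normD _ _) (lexx _)) _.
have := zk s st; have := zk t; rewrite lerDl ler01 => /(_ isT); lra.
Unshelve. all: by end_near. Qed.

(** Both [T z] and [z] are within [M / 2 ^+ k * weight t] of the iterate of index [k.+1], the first
    by contraction and the second by the limit estimate. *)
Let picard_fixpoint : T z = z.
Proof.
apply/funext => t; apply/eqP; rewrite -subr_eq0 -normr_le0.
apply/ler_addgt0Pr => e e0; rewrite add0r; apply: ltW.
have [|k ke] := @exists_div_exp2_lt R (2 * (2 * M * weight t)) e _ e0.
  exact: mulr_ge0.
apply: le_lt_trans ke.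
rewrite -(subrK (iterate k.+1 t) (T z t)) -addrA.
apply: le_trans (ler_normD _ _) _.
have Tz : `|T z t - iterate k.+1 t| <= 2 * M / 2 ^+ k / 2 * weight t.
  apply: picard_contraction.
  - exact: continuous_limit.
  - exact: continuous_iterate.
  - by apply: divr_ge0 => //; apply: mulr_ge0.
  - exact: limit_dist.
have zk : `|iterate k.+1 t - z t| <= 2 * M / 2 ^+ k / 2 * weight t.
  rewrite distrC; apply: le_trans (limit_dist k.+1 t) _.
  by rewrite exprSr invfM [X in X * weight t <= _]mulrA.
apply: le_trans (lerD Tz zk) _; set w := weight t.
have w0 : 0 <= 2 * M / 2 ^+ k * w by rewrite mulrAC divr_ge0 ?bound_ge0.
rewrite [leRHS](_ : _ = 2 * (2 * M / 2 ^+ k * w)); last by field; rewrite expf_neq0.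
rewrite [leLHS](_ : _ = 2 * M / 2 ^+ k * w); last by field; rewrite expf_neq0.
lra.
Qed.

Lemma lipschitz_trajectory_exists : exists2 z, trajectory f z & z 0 = z0.
Proof.
exists z; last by rewrite -picard_fixpoint picard_le0.
split; first exact/continuous_subspaceT/continuous_limit.
move=> t t0; apply: is_derive_col => i.
by rewrite -{1}picard_fixpoint; exact: is_derive_picard_coord.
Qed.

End picard.

(** * Stability of the cubic field *)

Section quartic.
Context {R : realType}.
Implicit Types (theta x y e t : R) (z : 'cV[R]_2).

Definition quartic (z : 'cV[R]_2) : R := z 0 0 ^+ 4 + z 1 0 ^+ 4.

Let lift01 : lift ord0 ord0 = 1 :> 'I_2.
Proof. exact/val_inj. Qed.

Lemma cubic_field0 theta z :
  cubic_field theta z 0 0 = - sin theta * z 0 0 ^+ 3 + cos theta * z 1 0 ^+ 3.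
Proof. by rewrite !mxE !big_ord_recl big_ord0 !mxE/= addr0 lift01. Qed.

Lemma cubic_field1 theta z :
  cubic_field theta z 1 0 = - cos theta * z 0 0 ^+ 3 - sin theta * z 1 0 ^+ 3.
Proof. by rewrite !mxE !big_ord_recl big_ord0 !mxE/= addr0 lift01 !mulNr. Qed.

Lemma norm_col2_le z e :
  0 <= e -> `|z 0 0| <= e -> `|z 1 0| <= e -> `|z| <= e.
Proof.
move=> e0 z0 z1; apply: col_norm_le => // i.
by case: (unliftP ord0 i) => [j|] ->//; rewrite (ord1 j) lift01.
Qed.

Lemma expr4_ge0 x : 0 <= x ^+ 4.
Proof. exact: (@exprn_even_ge0 _ 4). Qed.

Lemma normr_expr4 x : `|x| ^+ 4 = x ^+ 4.
Proof. by rewrite -normrX ger0_norm ?expr4_ge0. Qed.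

Lemma quartic_ge0 z : 0 <= quartic z.
Proof. by rewrite addr_ge0 ?expr4_ge0. Qed.

Lemma expr4_coord_le_quartic z : z 0 0 ^+ 4 <= quartic z /\ z 1 0 ^+ 4 <= quartic z.
Proof. by rewrite lerDl lerDr !expr4_ge0. Qed.

Lemma norm_lt_of_expr4 x e : 0 < e -> x ^+ 4 < e ^+ 4 -> `|x| < e.
Proof.
by move=> e0; rewrite -normr_expr4 ltr_pXn2r ?nnegrE// ltW.
Qed.

Lemma norm_lt_of_quartic z e : 0 < e -> quartic z < e ^+ 4 -> `|z| < e.
Proof.
move=> e0 ze; have [z0 z1] := expr4_coord_le_quartic z.
have H0 := norm_lt_of_expr4 _ _ e0 (le_lt_trans z0 ze).
have H1 := norm_lt_of_expr4 _ _ e0 (le_lt_trans z1 ze).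
apply: (@le_lt_trans _ _ (Num.max `|z 0 0| `|z 1 0|)).
  by apply: norm_col2_le; rewrite le_max ?lexx ?orbT ?normr_ge0.
by rewrite gt_max H0.
Qed.

Lemma quartic_le z : quartic z <= 2 * `|z| ^+ 4.
Proof.
rewrite mulr_natl mulr2n /quartic.
by apply: lerD; rewrite -normr_expr4 lerXn2r ?nnegrE// ler_coord_norm.
Qed.

Lemma continuous_quartic : continuous quartic.
Proof.
have c4 (i : 'I_2) : continuous (fun z : 'cV[R]_2 => z i 0 ^+ 4).
  move=> z; have cz := @coord_continuous R 2 1 i 0 z.
  exact: (continuous_comp cz (@exprn_continuous R 4 (z i 0))).
by move=> z; exact: (cvgD (c4 0 z) (c4 1 z)).
Qed.

Lemma is_derive_quartic (z : R -> 'cV[R]_2) (v : 'cV[R]_2) t :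
  is_derive t 1 z v ->
  is_derive t 1 (quartic \o z)
    (4 * (z t 0 0 ^+ 3 * v 0 0 + z t 1 0 ^+ 3 * v 1 0)).
Proof.
move=> dz; have d0 := is_derive_coord _ _ _ 0 dz.
have d1 := is_derive_coord _ _ _ 1 dz.
apply: is_derive_eq; rewrite /GRing.scale/=; ring.
Qed.

(** The gradient of the quartic is 4 times the vector of cubes to which the matrix is applied, so
    the skew-symmetric cosine part contributes nothing. *)
Lemma quartic_orbital theta z :
  4 * (z 0 0 ^+ 3 * cubic_field theta z 0 0 + z 1 0 ^+ 3 * cubic_field theta z 1 0) =
  - (4 * sin theta * (z 0 0 ^+ 6 + z 1 0 ^+ 6)).
Proof. rewrite cubic_field0 cubic_field1; ring. Qed.

(** * Truncation of the field and existence of trajectories *)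

Lemma normr_cube_diff_le x y : `|x| <= 1 -> `|y| <= 1 ->
  `|x ^+ 3 - y ^+ 3| <= 3 * `|x - y|.
Proof.
move=> x1 y1.
have -> : x ^+ 3 - y ^+ 3 = (x ^+ 2 + x * y + y ^+ 2) * (x - y) by ring.
rewrite normrM ler_wpM2r//.
apply: le_trans (ler_normD _ _) _.
apply: le_trans (lerD (ler_normD _ _) (lexx _)) _.
rewrite !normrX normrM.
have := normr_ge0 x; have := normr_ge0 y; nra.
Qed.

Definition clip (x : R) : R := Num.max (-1) (Num.min x 1).

Lemma normr_clip_le1 x : `|clip x| <= 1.
Proof.
rewrite ler_norml /clip le_max lexx ge_max ge_min lexx orbT andbT/=; lra.
Qed.

Lemma clip_id x : `|x| <= 1 -> clip x = x.
Proof.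
by rewrite ler_norml => /andP[x1 x2]; rewrite /clip (min_l x2) max_r.
Qed.

Lemma normr_clip_diff_le x y : `|clip x - clip y| <= `|x - y|.
Proof.
rewrite /clip; have [x1|x1] := leP x 1; have [y1|y1] := leP y 1;
  have [x2|x2] := leP (-1) x; have [y2|y2] := leP (-1) y;
  have [?|?] := leP (-1) (1 : R);
  rewrite ler_norml; case: (ger0P (x - y)) => ?; apply/andP; split; lra.
Qed.

(* Globally Lipschitz, and equal to the cubic field on [quartic z < 1], which
   its trajectories do not leave. *)
Definition clipped_field theta z : 'cV[R]_2 :=
  cubic_field theta (map_mx clip z).

(** Each coordinate combines two cubes with coefficients of modulus at most 1, and the cube is
    3-Lipschitz on the range of [clip]; hence the constant 6. *)
Lemma clipped_field_lipschitz theta z w :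
  `|clipped_field theta z - clipped_field theta w| <= 6 * `|z - w|.
Proof.
have trig a b : a ^+ 2 + b ^+ 2 = 1 -> `|a| <= 1 :> R.
  move=> ab; rewrite ler_norml; apply/andP; split; nra.
have sin1 : `|sin theta| <= 1.
  by apply: (trig _ (cos theta)); rewrite addrC cos2Dsin2.
have cos1 : `|cos theta| <= 1.
  by apply: (trig _ (sin theta)); rewrite cos2Dsin2.
have cube i : `|clip (z i 0) ^+ 3 - clip (w i 0) ^+ 3| <= 3 * `|z - w|.
  apply: le_trans (normr_cube_diff_le _ _ (normr_clip_le1 _) (normr_clip_le1 _)) _.
  rewrite ler_wpM2l//; apply: le_trans (normr_clip_diff_le _ _) _.
  by have := ler_coord_norm (z - w) i; rewrite !mxE.
have comb a b x y : `|a| <= 1 -> `|b| <= 1 ->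
    `|x| <= 3 * `|z - w| -> `|y| <= 3 * `|z - w| ->
    `|a * x + b * y| <= 6 * `|z - w|.
  move=> a1 b1 xl yl; apply: le_trans (ler_normD _ _) _; rewrite !normrM.
  have : `|a| * `|x| <= 1 * (3 * `|z - w|) by rewrite ler_pM.
  have : `|b| * `|y| <= 1 * (3 * `|z - w|) by rewrite ler_pM.
  lra.
apply: norm_col2_le; first by rewrite mulr_ge0.
- have -> : (clipped_field theta z - clipped_field theta w) 0 0 =
      - sin theta * (clip (z 0 0) ^+ 3 - clip (w 0 0) ^+ 3) +
      cos theta * (clip (z 1 0) ^+ 3 - clip (w 1 0) ^+ 3).
    by rewrite mxE [X in _ + X]mxE !cubic_field0 !mxE; ring.
  by apply: comb; rewrite ?normrN.
- have -> : (clipped_field theta z - clipped_field theta w) 1 0 =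
      - cos theta * (clip (z 0 0) ^+ 3 - clip (w 0 0) ^+ 3) +
      - sin theta * (clip (z 1 0) ^+ 3 - clip (w 1 0) ^+ 3).
    by rewrite mxE [X in _ + X]mxE !cubic_field1 !mxE; ring.
  by apply: comb; rewrite ?normrN.
Qed.

Lemma clipped_field_id theta z :
  quartic z < 1 -> clipped_field theta z = cubic_field theta z.
Proof.
move=> z1; congr (cubic_field theta _); apply/matrixP => i j.
rewrite (ord1 j) mxE clip_id//; apply: le_trans (ler_coord_norm _ _) _.
by apply/ltW/norm_lt_of_quartic; rewrite ?expr1n.
Qed.

Lemma expr6_ge0 x : 0 <= x ^+ 6.
Proof. exact: (@exprn_even_ge0 _ 6). Qed.

Lemma quartic_orbital_le0 theta z : 0 < sin theta ->
  4 * (z 0 0 ^+ 3 * cubic_field theta z 0 0 +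
       z 1 0 ^+ 3 * cubic_field theta z 1 0) <= 0.
Proof.
move=> s0; rewrite quartic_orbital oppr_le0.
by rewrite !mulr_ge0 ?addr_ge0 ?expr6_ge0 ?(ltW s0).
Qed.

(** A trajectory of the clipped field is trapped in [quartic z < 1], where the two fields agree. The
    sign of the orbital derivative is available only there, which is why [sublevel_trapping] asks
    for it only below [m]. *)
Lemma cubic_field_trajectory_exists theta (z0 : 'cV[R]_2) :
  0 < sin theta -> quartic z0 < 1 ->
  exists2 z, trajectory (cubic_field theta) z & z 0 = z0.
Proof.
move=> s0 z01.
have [||z [cz dz] z0E] :=
  @lipschitz_trajectory_exists R 2 (clipped_field theta) 6 _ _ z0.
- by [].
- exact: clipped_field_lipschitz.
exists z => //; split => // t t0.
rewrite -clipped_field_id; first exact: dz.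
apply: (@le_lt_trans _ _ (quartic (z 0))); last by rewrite z0E.
apply: (@sublevel_trapping _ (quartic \o z) _ 1); last exact: ltW.
- by apply: within_continuous_comp cz => u _; exact: continuous_quartic.
- by move=> u u0; apply: is_derive_quartic; exact: dz.
- move=> u u0 /= zu; rewrite clipped_field_id//; exact: quartic_orbital_le0.
- by rewrite /= z0E.
Qed.

(** * Decay of the quartic along trajectories, and asymptotic stability *)

Lemma quartic_trajectory_nonincreasing theta (z : R -> 'cV[R]_2) (s t : R) :
  0 < sin theta -> trajectory (cubic_field theta) z -> 0 <= s -> s <= t ->
  quartic (z t) <= quartic (z s).
Proof.
move=> s0 [cz dz]; apply: (@is_derive_nonincreasing _ (quartic \o z)).
- by apply: within_continuous_comp cz => u _; exact: continuous_quartic.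
- by move=> u u0; apply: is_derive_quartic; exact: dz.
- by move=> u u0; exact: quartic_orbital_le0.
Qed.

(** Combines [(a + b)^2 <= 2 (a^2 + b^2)] with [x^8 <= x^6] on the unit interval. It bounds the
    decay rate of the quartic below in terms of the quartic itself. *)
Lemma sqr_quartic_le z : quartic z <= 1 ->
  quartic z ^+ 2 <= 2 * (z 0 0 ^+ 6 + z 1 0 ^+ 6).
Proof.
move=> z1; have [z01 z11] := expr4_coord_le_quartic z.
have expr8_le x : x ^+ 4 <= 1 -> (x ^+ 4) ^+ 2 <= x ^+ 6.
  move=> x41; have x21 : x ^+ 2 <= 1 by nra.
  rewrite -exprM (_ : (4 * 2 = 6 + 2)%N)// exprD.
  by rewrite ler_piMr ?expr6_ge0.
have := expr8_le _ (le_trans z01 z1); have := expr8_le _ (le_trans z11 z1).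
have := sqr_ge0 (z 0 0 ^+ 4 - z 1 0 ^+ 4); rewrite /quartic; lra.
Qed.

Lemma quartic_trajectory_small theta (z : R -> 'cV[R]_2) (m : R) :
  0 < sin theta -> trajectory (cubic_field theta) z -> quartic (z 0) < 1 ->
  0 < m -> exists2 t, 0 <= t & quartic (z t) < m.
Proof.
move=> s0 tz z1 m0; apply: contrapT => zm.
have {}zm t : 0 <= t -> m <= quartic (z t).
  by move=> t0; rewrite leNgt; apply/negP => H; apply: zm; exists t.
have [cz dz] := tz.
(* While the quartic stays at least [m], it decreases at rate at least [c]. By time [c^-1] it would
   have lost 1, more than its initial value. *)
pose c := 2 * sin theta * m ^+ 2.
have c0 : 0 < c by rewrite !mulr_gt0// exprn_gt0.
have : quartic (z c^-1) + c * c^-1 <= quartic (z 0) + c * 0.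
  apply: (@is_derive_nonincreasing _ (fun t => quartic (z t) + c * t)
    (fun t => 4 * (z t 0 0 ^+ 3 * cubic_field theta (z t) 0 0 +
       z t 1 0 ^+ 3 * cubic_field theta (z t) 1 0) + c)).
  - move=> u; apply: cvgD.
      apply: (@within_continuous_comp _ _ _ _ z quartic _ cz) => v _.
      exact: continuous_quartic.
    apply: (@continuous_subspaceT _ _ _ (fun t => c * t)) => v.
    exact: mulrl_continuous.
  - move=> u u0; apply: is_deriveD; first by apply: is_derive_quartic; exact: dz.
    by apply: is_derive_eq; rewrite /GRing.scale/= mulr1.
  - move=> u u0; rewrite quartic_orbital /c.
    have zu1 : quartic (z u) <= 1.
      apply: le_trans (ltW z1).
      exact: (quartic_trajectory_nonincreasing _ _ _ _ s0 tz (lexx 0) (ltW u0)).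
    have := sqr_quartic_le _ zu1.
    have : m ^+ 2 <= quartic (z u) ^+ 2.
      by rewrite lerXn2r ?nnegrE ?quartic_ge0 ?(ltW m0) ?zm ?(ltW u0).
    nra.
  - by [].
  - by rewrite invr_ge0 ltW.
rewrite divff ?gt_eqF// mulr0; have := quartic_ge0 (z c^-1); lra.
Qed.

Lemma cubic_field_asymptotically_stable theta :
  0 < sin theta -> asymptotically_stable (cubic_field theta).
Proof.
move=> s0.
(* Halving the radius absorbs the factor 2 of [quartic_le], as [2 * (e / 2)^4 = e^4 / 8]. *)
have small e z : 0 < e -> `|z| < e / 2 -> quartic z < e ^+ 4.
  move=> e0 ze; apply: le_lt_trans (quartic_le z) _.
  have : `|z| ^+ 4 <= (e / 2) ^+ 4 
    by rewrite lerXn2r ?nnegrE// ?divr_ge0 ?(ltW e0) ?(ltW ze).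
  have : 0 < e ^+ 4 by rewrite exprn_gt0.
  rewrite expr_div_n; lra.
have h0 : 0 < 1 / 2 :> R by rewrite divr_gt0.
have small1 z : `|z| < 1 / 2 -> quartic z < 1.
  by move=> /(small _ _ ltr01); rewrite expr1n.
split.
- rewrite /cubic_field (_ : map_mx _ 0 = 0) ?mulmx0//.
  by apply/matrixP => i j; rewrite !mxE expr0n.
- by exists (1 / 2) => // z0 /small1; exact: cubic_field_trajectory_exists.
- move=> e e0; exists (e / 2); first exact: divr_gt0.
  move=> z tz /(small _ _ e0) z0 t t0; apply: norm_lt_of_quartic => //.
  apply: le_lt_trans z0.
  exact: (quartic_trajectory_nonincreasing _ _ _ _ s0 tz (lexx 0) t0).
- exists (1 / 2) => // z tz /small1 z0; apply/cvgrPdist_lt => e e0.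
  (* One time with the quartic below [e ^+ 4] suffices, since monotonicity keeps it there. *)
  have [t0 t00 zt0] := quartic_trajectory_small _ _ _ s0 tz z0 (exprn_gt0 4 e0).
  near=> t; rewrite sub0r normrN; apply: norm_lt_of_quartic => //.
  apply: le_lt_trans zt0.
  apply: (quartic_trajectory_nonincreasing _ _ _ _ s0 tz t00).
  by near: t; apply: nbhs_pinfty_ge; rewrite num_real.
Unshelve. all: by end_near. Qed.

End quartic.

(** * Binary forms and Lyapunov functions *)

Section binary_forms.
Context {R : realType}.
Implicit Types (V : mpoly 2 R) (z : 'cV[R]_2).

Definition binary_monomial (d k : nat) : multinom 2 :=
  Multinom [tuple if i == 0 then (d - k)%N else k | i < 2].

Lemma binary_monomial0 d k : binary_monomial d k 0%R = (d - k)%N.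
Proof. by rewrite mnmE. Qed.

Lemma binary_monomial1 d k : binary_monomial d k 1%R = k.
Proof. by rewrite mnmE. Qed.

Lemma big_ord2 (T : Type) (idx : T) (op : Monoid.law idx) (F : 'I_2 -> T) :
  \big[op/idx]_(i < 2) F i = op (F 0) (F 1).
Proof.
rewrite big_ord_recl big_ord_recl big_ord0 Monoid.mulm1.
by congr (op (F _) (F _)); exact/val_inj.
Qed.

Lemma mdeg_binary_monomial d k : (k <= d)%N -> mdeg (binary_monomial d k) = d.
Proof.
by move=> kd; rewrite mdegE big_ord2 binary_monomial0 binary_monomial1 /= subnK.
Qed.

Lemma binary_monomial_homog d k : (k <= d)%N ->
  mpolyX R (binary_monomial d k) \is ishomog1 d mdeg.
Proof. by move=> kd; rewrite dhomogX; apply/eqP; exact: mdeg_binary_monomial. Qed.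

(** Coefficients are compared: a monomial of degree [d] in two variables is determined by its second
    exponent, and the others have coefficient zero on both sides. *)
Lemma binary_form_expand d V : V \is ishomog1 d mdeg ->
  V = \sum_(k < d.+1)
    mcoeff (binary_monomial d k) V *: mpolyX R (binary_monomial d k).
Proof.
move=> Vd; apply/mpolyP => m; rewrite raddf_sum/=.
under eq_bigr do rewrite mcoeffZ mcoeffX.
have [md|md] := eqVneq (mdeg m) d; last first.
  rewrite (dhomog_nemf_coeff Vd md) big1// => k _.
  have [E|_] := eqVneq (binary_monomial d k) m; last by rewrite mulr0.
  by case/eqP: md; rewrite -E mdeg_binary_monomial// -ltnS.
have m1 : (m 1%R < d.+1)%N by rewrite ltnS -md mdegE big_ord2 leq_addl.
have mE : m = binary_monomial d (m 1%R).
  apply/mnmP => i; rewrite mnmE; case: eqP => [->|i0].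
    by rewrite -md mdegE big_ord2 /= addnK.
  congr (m _); apply/val_inj; case: i i0 => [[|[|]]]//= ? i0.
  by case: i0; exact/val_inj.
rewrite (bigD1 (Ordinal m1))//= -mE eqxx mulr1 big1 ?addr0// => k kE.
have [E|_] := eqVneq (binary_monomial d k) m; last by rewrite mulr0.
by case/eqP: kE; apply/val_inj; rewrite /= -E binary_monomial1.
Qed.

Lemma binary_form_eval d V z : V \is ishomog1 d mdeg ->
  eval_at V z = \sum_(k < d.+1) mcoeff (binary_monomial d k) V *
    (z 0 0 ^+ (d - k) * z 1 0 ^+ k).
Proof.
move=> /binary_form_expand VE; rewrite /eval_at [in LHS]VE raddf_sum.
apply: eq_bigr => k _ /=.
by rewrite mevalZ mevalX big_ord2 binary_monomial0 binary_monomial1.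
Qed.

(** The truncated predecessor is harmless: when the exponent is 0, so is the numerical factor in
    front. The same holds for the other partial derivative. *)
Lemma binary_form_eval_mderiv0 d V z : V \is ishomog1 d mdeg ->
  eval_at (mderiv 0 V) z = \sum_(k < d.+1) mcoeff (binary_monomial d k) V *
    ((d - k)%:R * z 0 0 ^+ (d - k).-1 * z 1 0 ^+ k).
Proof.
move=> /binary_form_expand VE.
rewrite /eval_at [in LHS]VE (raddf_sum (mderiv 0)) raddf_sum.
apply: eq_bigr => k _ /=.
rewrite mderivZ mderivX !mevalZ mevalX big_ord2 !mnmBE !mnm1E.
by rewrite binary_monomial0 binary_monomial1 /= subn1 subn0 !mulrA.
Qed.

Lemma binary_form_eval_mderiv1 d V z : V \is ishomog1 d mdeg ->
  eval_at (mderiv 1 V) z = \sum_(k < d.+1) mcoeff (binary_monomial d k) V *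
    (k%:R * z 0 0 ^+ (d - k) * z 1 0 ^+ k.-1).
Proof.
move=> /binary_form_expand VE.
rewrite /eval_at [in LHS]VE (raddf_sum (mderiv 1)) raddf_sum.
apply: eq_bigr => k _ /=.
rewrite mderivZ mderivX !mevalZ mevalX big_ord2 !mnmBE !mnm1E.
by rewrite binary_monomial0 binary_monomial1 /= subn1 subn0 !mulrA.
Qed.

End binary_forms.

(** * The quartic Lyapunov function and the obstruction in degree 6 *)

Section lyapunov.
Context {R : realType}.
Implicit Types (theta x y : R) (z : 'cV[R]_2) (V : mpoly 2 R).

Definition col2 (x y : R) : 'cV[R]_2 := \col_i if i == 0 then x else y.

Lemma col2_neq0 x y : x != 0 -> col2 x y != 0.
Proof.
by apply: contra_neq => /matrixP/(_ 0 0); rewrite !mxE.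
Qed.

Lemma col2_neq0r x y : y != 0 -> col2 x y != 0.
Proof.
by apply: contra_neq => /matrixP/(_ 1 0); rewrite !mxE.
Qed.

Lemma orbital_derivative2 (f : 'cV[R]_2 -> 'cV[R]_2) V z :
  orbital_derivative f V z =
  eval_at (mderiv 0 V) z * f z 0 0 + eval_at (mderiv 1 V) z * f z 1 0.
Proof. by rewrite /orbital_derivative big_ord2 /grad !mxE. Qed.

Lemma quartic_lyapunov theta : 0 < sin theta ->
  exists V, homogeneous_lyapunov 4 (cubic_field theta) V.
Proof.
move=> s0.
pose V := mpolyX R (binary_monomial 4 0) + mpolyX R (binary_monomial 4 4).
(* Serves with [n = 4] for positivity and with [n = 6] for the orbital derivative. *)
have pos n z : ~~ odd n -> (0 < n)%N -> z != 0 -> 0 < z 0 0 ^+ n + z 1 0 ^+ n.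
  move=> no n0; apply: contraTT; rewrite -leNgt negbK => zn.
  have z0 := exprn_even_ge0 (z 0 0) no; have z1 := exprn_even_ge0 (z 1 0) no.
  have : z 0 0 ^+ n = 0 by lra.
  have : z 1 0 ^+ n = 0 by lra.
  move/eqP; rewrite expf_eq0 n0 => /eqP z10 /eqP; rewrite expf_eq0 n0 => /eqP z00.
  apply/eqP/matrixP => i j; rewrite (ord1 j) mxE.
  case: (unliftP ord0 i) => [k|] ->//.
  by rewrite (ord1 k) -z10; congr (z _ _); exact/val_inj.
exists V; split.
- by rewrite rpredD ?binary_monomial_homog.
- move=> z /(pos 4%N _ isT isT); congr (0 < _).
  rewrite /eval_at mevalD !mevalX !big_ord2 !binary_monomial0 !binary_monomial1.
  by rewrite /= !expr0 mulr1 mul1r.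
- move=> z zn0; rewrite orbital_derivative2 /V /eval_at !mderivD !mderivX.
  rewrite !mevalD !mevalZ !mevalX.
  rewrite !big_ord2 !mnmBE !mnm1E !binary_monomial0 !binary_monomial1 /=.
  rewrite (_ : _ + _ = - (4 * sin theta * (z 0 0 ^+ 6 + z 1 0 ^+ 6))).
    by rewrite oppr_lt0 mulr_gt0 ?mulr_gt0// pos.
  rewrite -quartic_orbital !subn1 !subn0 !subnn /=; ring.
Qed.

(** The general binary sextic invariant under the quarter turn (x,y) |-> (y,-x); the monomial x^3
    y^3 changes sign and is excluded. *)
Definition sextic (A B C x y : R) : R :=
  A * (x ^+ 6 + y ^+ 6) + B * (x ^+ 5 * y - x * y ^+ 5) +
  C * (x ^+ 4 * y ^+ 2 + x ^+ 2 * y ^+ 4).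

Definition sextic_dx (A B C x y : R) : R :=
  A * (6 * x ^+ 5) + B * (5 * x ^+ 4 * y - y ^+ 5) +
  C * (4 * x ^+ 3 * y ^+ 2 + 2 * x * y ^+ 4).

Definition sextic_dy (A B C x y : R) : R :=
  A * (6 * y ^+ 5) + B * (x ^+ 5 - 5 * x * y ^+ 4) +
  C * (2 * x ^+ 4 * y + 4 * x ^+ 2 * y ^+ 3).

(* The field commutes with the quarter turn (x,y) |-> (y,-x). *)
Lemma sextic_symmetrisation theta V : V \is ishomog1 6 mdeg ->
  exists A B C, forall x y,
    eval_at V (col2 x y) + eval_at V (col2 y (- x)) = sextic A B C x y /\
    orbital_derivative (cubic_field theta) V (col2 x y) +
    orbital_derivative (cubic_field theta) V (col2 y (- x)) =
    sextic_dx A B C x y * (- sin theta * x ^+ 3 + cos theta * y ^+ 3) +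
    sextic_dy A B C x y * (- cos theta * x ^+ 3 - sin theta * y ^+ 3).
Proof.
move=> V6; pose a k := mcoeff (binary_monomial 6 k) V.
(* The turn swaps the monomials [k] and [6 - k], with a minus sign for odd [k]; so [a 3] cancels in
   the sum. *)
exists (a 0%N + a 6%N), (a 1%N - a 5%N), (a 2%N + a 4%N) => x y.
rewrite !orbital_derivative2 !cubic_field0 !cubic_field1.
rewrite !(binary_form_eval _ _ _ V6) !(binary_form_eval_mderiv0 _ _ _ V6).
rewrite !(binary_form_eval_mderiv1 _ _ _ V6).
rewrite !big_ord_recl !big_ord0 /= /bump /= !addn0 !add1n !subSS !subn0 !mxE /=.
rewrite /sextic /sextic_dx /sextic_dy.
rewrite -!/(a _).
move: (sin theta) (cos theta) (a 0%N) (a 1%N) (a 2%N) (a 3%N) (a 4%N) (a 5%N)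
  (a 6%N).
by move=> s c a0 a1 a2 a3 a4 a5 a6; split; ring.
Qed.

(* The field for [s = 0] is conservative, so there the derivative could only be
   nonpositive if it vanished. The points (1,0) and (1,1) then give [B = 0], and
   (2,1), (2,-1), (3,1), (3,-1) give [A = C = 0]. The contradiction with [A > 0]
   survives the perturbation as long as [s / c] is small. *)
Lemma no_sextic_lyapunov (s c A B C : R) : 0 < s -> 1000 * s < c ->
  (forall x y, x != 0 -> 0 < sextic A B C x y) ->
  (forall x y, x != 0 ->
    sextic_dx A B C x y * (- s * x ^+ 3 + c * y ^+ 3) +
    sextic_dy A B C x y * (- c * x ^+ 3 - s * y ^+ 3) < 0) -> False.
Proof.
move=> s0 sc Vpos Vneg.
have c0 : 0 < c by lra.
(* Dividing by [c] leaves the single small parameter [t], the tangent of the angle. *)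
pose t := s / c.
have t0 : 0 < t by rewrite divr_gt0.
have t1 : 1000 * t < 1 by rewrite mulrA ltr_pdivrMr// mul1r.
have {}Vneg x y : x != 0 ->
    sextic_dx A B C x y * (- t * x ^+ 3 + y ^+ 3) +
    sextic_dy A B C x y * (- x ^+ 3 - t * y ^+ 3) < 0.
  move=> /(Vneg _ y) H; rewrite -(pmulr_rlt0 _ c0); move: H; congr (_ < 0).
  by rewrite /t; field; rewrite gt_eqF.
have n1 : 1 != 0 :> R by [].
have n2 : 2 != 0 :> R by rewrite pnatr_eq0.
have n3 : 3 != 0 :> R by rewrite pnatr_eq0.
(* For [t = 0] and [B = 0] the derivative is [144 A - 348 C] at (2,1) and [1296 A - 5232 C] at
   (3,1), with opposite values at (2,-1) and (3,-1). Their vanishing would require the distinct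
   ratios 12/29 and 27/109 for [C / A]. *)
have := Vpos 1 0 n1; have := Vpos 1 1 n1.
have := Vneg 1 0 n1; have := Vneg 1 1 n1.
have := Vneg 2 1 n2; have := Vneg 2 (-1) n2.
have := Vneg 3 1 n3; have := Vneg 3 (-1) n3.
rewrite /sextic /sextic_dx /sextic_dy => v1 v2 v3 v4 v5 v6 w1 w2.
(* With these bounds the products by [t] become separate unknowns of a linear problem. [A] and
   [A + C] are positive by the values at (1,0) and (1,1); the sign of [B] is unknown, hence the case
   split. *)
have tA : 0 < t * A /\ 1000 * (t * A) < A by nra.
have tAC : 0 < t * (A + C) /\ 1000 * (t * (A + C)) < A + C by nra.
have [B0|B0] := leP 0 B.
- have tB : 0 <= t * B /\ 1000 * (t * B) <= B by nra.
  lra.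
- have tB : t * B <= 0 /\ B <= 1000 * (t * B) by nra.
  lra.
Qed.

End lyapunov.

(** * The interval of angles and the conclusion *)

Lemma exists_small_angle {R : realType} : exists2 b : R, 0 < b &
  forall theta, 0 < theta < b -> 0 < sin theta /\ 1000 * sin theta < cos theta.
Proof.
have cf : continuous (fun t : R => cos t - 1000 * sin t).
  move=> t; apply: cvgB; first exact: continuous_cos.
  by apply: cvgMr; exact: continuous_sin.
(* The function [cos - 1000 sin] equals 1 at 0, so it stays positive nearby. *)
have /cvgr_gt/(_ 0) := cf 0.
rewrite cos0 sin0 mulr0 subr0 => /(_ ltr01)[e /= e0 H].
(* The cap at [pi] keeps the sine positive. *)
exists (Num.min e pi); first by rewrite lt_min e0 pi_gt0.
move=> theta; rewrite lt_min => /andP[t0 /andP[te tpi]]; split.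
  by apply: sin_gt0_pi; rewrite t0.
by rewrite -subr_gt0; apply: H; rewrite /= sub0r normrN gtr0_norm.
Qed.

Theorem mainTheorem3 (R : realType) :
  exists a b : R, [/\ 0 <= a, a < b &
    forall theta : R, a < theta < b ->
      [/\ asymptotically_stable (cubic_field theta),
          ~ (exists V : mpoly 2 R,
               homogeneous_lyapunov 6 (cubic_field theta) V)
        & exists V : mpoly 2 R,
            homogeneous_lyapunov 4 (cubic_field theta) V]].
Proof.
have [b b0 small] := @exists_small_angle R.
exists 0, b; split=> // theta /small[s0 sc]; split.
- exact: cubic_field_asymptotically_stable.
- move=> [V [V6 Vpos Vneg]].
  have [A [B [C ABC]]] := sextic_symmetrisation theta V V6.
  (* Both sign conditions pass to the sum over the quarter turn, because the turned point (y,-x) is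
     nonzero as well. *)
  apply: (@no_sextic_lyapunov R _ _ A B C s0 sc) => x y x0;
    have [E1 E2] := ABC x y.
  + rewrite -E1; apply: addr_gt0; apply: Vpos; first exact: col2_neq0.
    by apply: col2_neq0r; rewrite oppr_eq0.
  + rewrite -E2 -[ltRHS]addr0; apply: ltrD; apply: Vneg; first exact: col2_neq0.
    by apply: col2_neq0r; rewrite oppr_eq0.
- exact: quartic_lyapunov.
Qed.
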